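(* Let $A\in\mathbb{R}^{d\times n}$ be a matrix of full row rank $d$ with no zero columns and let $\mathcal{L}^{-1}$ be its reciprocal plane, regarded as an affine variety in $\mathbb{C}^n$. For any point $p\in\mathcal{L}^{-1}$ with support $J=\{i: p_i\neq 0\}$, the tangent cone of $\mathcal{L}^{-1}$ at $p$ is isomorphic to the direct product $$\mathrm{TC}_p\mathcal{L}^{-1}\;\cong\;\mathcal{L}_J\times\mathcal{L}^{-1}_{A/J},$$ where ''$\cong$'' denotes equality of affine schemes after a linear transformation of $\mathbb{C}^n$.
   Context: $\mathcal{L}\subset\mathbb{C}^n$ is the row space of $A$, and the reciprocal plane $\mathcal{L}^{-1}\subset\mathbb{C}^n$ is the Zariski closure of $\{(1/u_1,\dots,1/u_n): u\in\mathcal{L}\cap(\mathbb{C}^* )^n\}$; it is irreducible of dimension $d$. The support $J$ of any point of $\mathcal{L}^{-1}$ is a flat of the matroid of $A$ (i.e. $J=\{i: A_i\in\mathrm{span}(A_j:j\in J)\}$, where $A_i$ are the columns). $\mathcal{L}_J\subset\mathbb{C}^J$ is the row space of the column submatrix $A_J=(A_j:j\in J)$. $A/J$ denotes the contraction, i.e. the configuration of images of the columns $A_i$, $i\in J^c=[n]\setminus J$, in $\mathbb{R}^d/\mathrm{span}(A_j:j\in J)$; $\mathcal{L}_{A/J}\subset\mathbb{C}^{J^c}$ is its row space, i.e. $\{u_{J^c}: u\in\mathcal{L},\ u_J=0\}$, of dimension $d-\mathrm{rank}(A_J)$, and $\mathcal{L}_{A/J}^{-1}\subset\mathbb{C}^{J^c}$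 is the reciprocal plane of $\mathcal{L}_{A/J}$ (Zariski closure of coordinatewise inverses of its points with all coordinates nonzero). For $0\ne f\in\mathbb{C}[\mathbf{x}]$, let $\mathrm{in}_{-\mathbf{1}}(f)$ be the nonzero homogeneous component of $f$ of minimal degree. The tangent cone $\mathrm{TC}_pX$ of a variety $X\subset\mathbb{C}^n$ at $p$ is the affine scheme in $\mathbb{C}^n$ defined by the ideal $\langle \mathrm{in}_{-\mathbf{1}}(f(\mathbf{x}+p)): f\in I(X)\rangle$. *)

(* Defs.v *)
From HB Require Import structures.
From mathcomp Require Import all_boot all_order all_algebra.
From mathcomp Require Import classical_sets reals.
From mathcomp Require Import complex mpoly.

Set Implicit Arguments.
Unset Strict Implicit.
Unset Printing Implicit Defensive.

Import GRing.Theory.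
Local Open Scope ring_scope.
Local Open Scope classical_set_scope.
Local Open Scope complex_scope.

(* Points of affine space F^n are row vectors; a linear map acts on them by    *)
(* right multiplication. For J : {set 'I_n}, F^J is 'rV[F]_#|J|, its           *)
(* coordinates being listed by enum_val : 'I_#|J| -> 'I_n, so that F^n is      *)
(* F^J x F^(~: J).                                                             *)

Section AffineGeometry.

Variable F : fieldType.
Implicit Types n : nat.

Definition vanishing_ideal n (X : set 'rV[F]_n) : set {mpoly F[n]} :=
  [set f | forall x, X x -> f.@[x 0] = 0].

Definition zariski_closure n (X : set 'rV[F]_n) : set 'rV[F]_n :=
  [set x | forall f, vanishing_ideal X f -> f.@[x 0] = 0].

Definition generated_ideal n (G : set {mpoly F[n]}) : set {mpoly F[n]} :=
  [set f | exists2 s : seq ({mpoly F[n]} * {mpoly F[n]}),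
    (forall hg, hg \in s -> G hg.2) & f = \sum_(hg <- s) hg.1 * hg.2].

Definition reciprocal_plane n (L : set 'rV[F]_n) : set 'rV[F]_n :=
  zariski_closure
    [set map_mx GRing.inv u | u in [set u | L u /\ forall i, u 0 i != 0]].

Definition point_support n (p : 'rV[F]_n) : {set 'I_n} := [set i | p 0 i != 0]%SET.

Definition initial_degree n (f : {mpoly F[n]}) : nat :=
  \big[minn/msize f]_(m <- msupp f) mdeg m.

Definition initial_form n (f : {mpoly F[n]}) : {mpoly F[n]} :=
  pihomog mdeg (initial_degree f) f.

(* f(x + p) *)
Definition translate n (p : 'rV[F]_n) (f : {mpoly F[n]}) : {mpoly F[n]} :=
  f \mPo [tuple 'X_i + (p 0 i)%:MP | i < n].

(* f(x M) *)
Definition linear_subst n (M : 'M[F]_n) (f : {mpoly F[n]}) : {mpoly F[n]} :=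
  f \mPo [tuple \sum_(j < n) M j i *: 'X_j | i < n].

(* A closed subscheme of F^n is given by its ideal, not assumed radical.       *)

Definition tangent_cone n (X : set 'rV[F]_n) (p : 'rV[F]_n) :
    set {mpoly F[n]} :=
  generated_ideal
    [set initial_form (translate p f)
       | f in [set f | vanishing_ideal X f /\ f != 0]].

(* F[x_J] -> F[x_1, ..., x_n] *)
Definition widen_vars n (J : {set 'I_n}) (f : {mpoly F[#|J|]}) :
    {mpoly F[n]} :=
  f \mPo [tuple 'X_(enum_val k) | k < #|J|].

(* The product of the subschemes V(I1) of F^J and V(I2) of F^(~: J): its       *)
(* coordinate ring is the tensor product of F[x_J]/I1 and F[x_(~: J)]/I2.      *)
Definition scheme_product n (J : {set 'I_n})
    (I1 : set {mpoly F[#|J|]}) (I2 : set {mpoly F[#|~: J|%SET]}) :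
    set {mpoly F[n]} :=
  generated_ideal
    ([set widen_vars f | f in I1] `|` [set widen_vars f | f in I2]).

(* V(I2) is the image of V(I1) under the automorphism x |-> x M of F^n.        *)
Definition linearly_isomorphic n (I1 I2 : set {mpoly F[n]}) : Prop :=
  exists2 M : 'M[F]_n, M \in unitmx &
    forall f, I2 f <-> I1 (linear_subst M f).

End AffineGeometry.

Definition restrict_cols (F : fieldType) m n (J : {set 'I_n})
    (A : 'M[F]_(m, n)) : 'M[F]_(m, #|J|) :=
  colsub (fun k : 'I_#|J| => enum_val k) A.

(* The rows of K := row_base (kermx A_J) are a basis of the linear forms       *)
(* on F^d vanishing on the columns A_j, j in J. Hence v |-> K *m v is onto     *)
(* with kernel span(A_j : j in J): it is the projection F^d -> F^d / span(A_j) *)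
(* in coordinates.                                                             *)
Definition contraction (F : fieldType) d n (A : 'M[F]_(d, n))
    (J : {set 'I_n}) :
    'M[F]_(\rank (kermx (restrict_cols J A)), #|~: J|%SET) :=
  row_base (kermx (restrict_cols J A)) *m restrict_cols (~: J)%SET A.

Definition row_space (R : realType) m n (A : 'M[R]_(m, n)) :
    set 'rV[R[i]]_n :=
  [set u | (u <= map_mx (real_complex R) A)%MS].

Lemma row_space_contraction (R : realType) d n (A : 'M[R]_(d, n))
    (J : {set 'I_n}) :
  row_space (contraction A J) =
  [set restrict_cols (~: J)%SET u
     | u in [set u | row_space A u /\ restrict_cols J u = 0]].
Proof.
have mapC (K : {set 'I_n}) : map_mx (real_complex R) (restrict_cols K A)
    = restrict_cols K (map_mx (real_complex R) A).
  by apply/matrixP => i j; rewrite !mxE.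
have mulC (K : {set 'I_n}) k (B : 'M[R[i]]_(k, d)) C :
    restrict_cols K (B *m C) = B *m restrict_cols K C.
  by apply/matrixP => i j; rewrite !mxE; apply: eq_bigr => l _; rewrite !mxE.
rewrite /row_space /contraction map_mxM mapC.
set AC := map_mx _ A; set K := map_mx _ _.
have eqK : (K :=: kermx (restrict_cols J AC))%MS.
  apply/eqmxP; rewrite -mapC -map_kermx !map_submx.
  by rewrite !eq_row_base !submx_refl.
apply/seteqP; split => [v /= /submxP[w ->]|_ /= [u [/submxP[w ->] uJ0] <-]].
  exists (w *m K *m AC); last by rewrite mulC mulmxA.
  split; first exact: submxMl.
  have /sub_kermxP KA0 : (K <= kermx (restrict_cols J AC))%MS by rewrite eqK.
  by rewrite mulC -mulmxA KA0 mulmx0.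
rewrite mulC submxMr // eqK; apply/sub_kermxP.
by rewrite -mulC.
Qed.

(* Main.v *)
Require Import Defs.
From HB Require Import structures.
From mathcomp Require Import all_boot all_order all_algebra.
From mathcomp Require Import classical_sets reals.
From mathcomp Require Import complex mpoly.
From mathcomp Require Import ring.

(* The isomorphism is the diagonal map M with entries p_j^-2 on J and 1 off J. *)
(* Some q in L restricts to 1/p on J.                                          *)
(*                                                                             *)
(* For v in L, and u in L with u_J = 0 and no zero entry off J, the curve      *)
(* 1/(q - t v + u/t) lies in L^-1 and equals p + t y + O(t^2), where y is      *)
(* p^2 v on J and 1/u off J. Hence the initial forms at p of the equations of  *)
(* L^-1 vanish at all such y, that is, on the preimage under M of the product; *)
(* and the vanishing ideal of the product is the sum of the two ideals.        *)
(*                                                                             *)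
(* Conversely, a homogeneous equation g of one factor lifts to an equation of  *)
(* L^-1. If u = 1/x is in L, then u_J - q_J is in L_J and w = u - s(u_J), with *)
(* s a linear section of L -> L_J, satisfies w_J = 0. Clearing denominators in *)
(* g(u_J - q_J), resp. g(1/w), gives g((x_i - p_i) C_i(x)) times a factor that *)
(* is nonzero at p, whose initial form at p is g(y_i C_i(p)) up to a constant, *)
(* and C_i(p) is a constant multiple of the entry M_ii.                        *)

Set Implicit Arguments.
Unset Strict Implicit.
Unset Printing Implicit Defensive.

Import GRing.Theory Num.Theory.
Local Open Scope ring_scope.
Local Open Scope classical_set_scope.
Local Open Scope complex_scope.

(** The claim is an equality of ideals, multiplicities included, so it splits into two inclusions.

    Every element of the tangent cone ideal vanishes on the preimage under [M] of a dense part of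
    the product. This is [tangent_cone_vanish], which feeds explicit curves through p into
    [initial_form_curve]. Pointwise vanishing becomes ideal membership by [vanishing_ideal_product]:
    the ideals of the two factors together generate the whole vanishing ideal of the product.

    For the other inclusion both factors are cones, so [tangent_cone_widen] reduces to homogeneous
    generators. For those, [tangent_cone_linear] and [tangent_cone_contraction] write down equations
    of L^-1 whose initial forms at p are the required pullbacks up to a nonzero constant;
    [tangent_cone_mem] is the common computation. *)

(** * Ring morphisms on polynomials and homogeneity *)

Lemma mpoly_rmorph_ext (n : nat) (R : comNzRingType) (S : nzRingType)
    (f g : {rmorphism {mpoly R[n]} -> S}) :
  (forall c, f c%:MP = g c%:MP) -> (forall i, f 'X_i = g 'X_i) -> f =1 g.
Proof.
move=> fgC fgX q; rewrite [q]mpolyE !rmorph_sum; apply: eq_bigr => m _.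
rewrite -mul_mpolyC !rmorphM /= fgC; congr (_ * _).
rewrite mpolyXE_id !rmorph_prod; apply: eq_bigr => i _.
by rewrite !rmorphXn /= fgX.
Qed.

Lemma mmap_homog (n : nat) (R : nzRingType) (S : comNzRingType) (f : R -> S)
    (h : 'I_n -> S) (t : S) (d : nat) (q : {mpoly R[n]}) :
  q \is d.-homog -> mmap f (fun i => t * h i) q = t ^+ d * mmap f h q.
Proof.
move=> /dhomogP homq; rewrite /mmap mulr_sumr; apply: eq_big_seq => m mq.
rewrite mulrCA; congr (_ * _).
have -> : d = mdeg m by rewrite -(homq m mq).
rewrite mdegE.
rewrite /mmap1 -prodrXr -big_split /=.
by apply: eq_bigr => i _; rewrite exprMn.
Qed.

Lemma meval_homog (R : comNzRingType) r e (g : {mpoly R[r]}) (c : R)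
    (v : 'I_r -> R) :
  g \is e.-homog -> g.@[fun i => c * v i] = c ^+ e * g.@[v].
Proof. exact: mmap_homog. Qed.

(** * Generated ideals *)

Section GeneratedIdeal.

Variables (F : fieldType) (n : nat) (G : set {mpoly F[n]}).
Implicit Types f g h : {mpoly F[n]}.

Lemma generated_ideal_gen f : G f -> generated_ideal G f.
Proof.
by exists [:: (1, f)]; rewrite ?big_seq1 ?mul1r // => hg; rewrite inE => /eqP->.
Qed.

Lemma generated_ideal0 : generated_ideal G 0.
Proof. by exists [::]; rewrite ?big_nil. Qed.

Lemma generated_idealD f g :
  generated_ideal G f -> generated_ideal G g -> generated_ideal G (f + g).
Proof.
move=> [s sG ->] [t tG ->]; exists (s ++ t); last by rewrite big_cat.
by move=> hg; rewrite mem_cat => /orP[/sG|/tG].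
Qed.

Lemma generated_idealM h f : generated_ideal G f -> generated_ideal G (h * f).
Proof.
move=> [s sG ->]; exists [seq (h * hg.1, hg.2) | hg <- s].
  by move=> _ /mapP[hg /sG ? ->].
by rewrite big_map mulr_sumr; apply: eq_bigr => hg _; rewrite mulrA.
Qed.

Lemma generated_ideal_sum (I : Type) (s : seq I) (P : pred I)
    (f : I -> {mpoly F[n]}) :
  (forall i, P i -> generated_ideal G (f i)) ->
  generated_ideal G (\sum_(i <- s | P i) f i).
Proof.
move=> fG; elim/big_ind: _ => //; first exact: generated_ideal0.
exact: generated_idealD.
Qed.

(** Congruence modulo an ideal respects sums and products, hence polynomial substitution. *)
Lemma comp_mpoly_congr k (q : {mpoly F[k]}) (a b : k.-tuple {mpoly F[n]}) :
  (forall i, generated_ideal G (tnth a i - tnth b i)) ->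
  generated_ideal G ((q \mPo a) - (q \mPo b)).
Proof.
move=> ab; pose R f g := generated_ideal G (f - g).
have Rrefl f : R f f by rewrite /R subrr; apply: generated_ideal0.
have RD f f' g g' : R f f' -> R g g' -> R (f + g) (f' + g').
  by rewrite /R opprD addrACA => *; apply: generated_idealD.
have RM f f' g g' : R f f' -> R g g' -> R (f * g) (f' * g').
  move=> Rf Rg; rewrite /R.
  have -> : f * g - f' * g' = g * (f - f') + f' * (g - g').
    by rewrite !mulrBr !(mulrC g) addrA subrK.
  by apply: generated_idealD; apply: generated_idealM.
rewrite -/(R _ _) !comp_mpolyE.
apply: (big_ind2 R); [exact: Rrefl|exact: RD|move=> m _].
 rewrite -!mul_mpolyC; apply: (RM) => //.
apply: (big_ind2 R); [exact: Rrefl|exact: RM|move=> i _].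
 elim: (m i) => [|e IHe]; first by rewrite !expr0.
by rewrite !exprS; apply: RM => //; apply: ab.
Qed.

End GeneratedIdeal.

(** * Polynomials are determined by their values in characteristic zero *)

Section PolynomialFunctions.

Variable F : numFieldType.

Lemma poly_fun0 (q : {poly F}) : (forall t, q.[t] = 0) -> q = 0.
Proof.
move=> q0; apply/eqP; apply/contraT => /max_poly_roots maxq.
(* In characteristic zero the first [size q] naturals are distinct, too many roots for a nonzero
   [q]. *)
pose s := [seq i%:R : F | i <- iota 0 (size q)].
suff: (size s < size q)%N by rewrite size_map size_iota ltnn.
apply: maxq; first by apply/allP => x _; apply/eqP.
by rewrite map_inj_uniq ?iota_uniq // => i j /eqP; rewrite eqr_nat => /eqP.
Qed.

Lemma poly_fun0_away (c q : {poly F}) :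
  c != 0 -> (forall t, c.[t] != 0 -> q.[t] = 0) -> q = 0.
Proof.
move=> c0 q0; suff /eqP : c * q = 0 by rewrite mulf_eq0 (negPf c0) => /eqP.
apply: poly_fun0 => t; rewrite hornerM; apply/eqP; rewrite mulf_eq0.
by have [//|/q0->] := eqVneq c.[t] 0; rewrite eqxx.
Qed.

Lemma mpoly_fun0 n (f : {mpoly F[n]}) : (forall v, f.@[v] = 0) -> f = 0.
Proof.
elim: n f => [|n IHn] f f0.
  have:= f0 (fun=> 0); rewrite (nvar0_mpolyC f) mevalC => ->.
  by rewrite mpolyC0.
(* [phi] reads [f] as a univariate polynomial in its last variable, and [psi] undoes this. The
   coefficients then fall under the induction hypothesis. *)
pose h i : {poly {mpoly F[n]}} :=
  if unlift ord_max i is Some j then ('X_j)%:P else 'X.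
pose phi := mmap (polyC \o @mpolyC n F) h.
pose psi (q : {poly {mpoly F[n]}}) : {mpoly F[n.+1]} :=
  (map_poly (mmap (@mpolyC n.+1 F) (fun i => 'X_(lift ord_max i))) q).['X_ord_max].
have psiphi : psi (phi f) = f.
  pose P := (horner_eval ('X_ord_max : {mpoly F[n.+1]}) \o
    map_poly (mmap (@mpolyC n.+1 F) (fun i => 'X_(lift ord_max i)))) \o phi.
  apply: (@mpoly_rmorph_ext _ _ _ P idfun) => [c|i] /=.
    by rewrite /phi mmapC /= map_polyC /= mmapC /horner_eval hornerC.
  rewrite /phi mmapX mmap1U /h /horner_eval.
  case: unliftP => [j|] ->; last by rewrite map_polyX hornerX.
  by rewrite map_polyC /= mmapX mmap1U hornerC.
suff phi0 : phi f = 0 by rewrite -psiphi phi0 /psi rmorph0 horner0.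
apply/polyP => k; rewrite coef0; apply: IHn => v.
suff E : map_poly (meval v) (phi f) = 0 by rewrite -coef_map E coef0.
apply: poly_fun0 => t; pose w i := if unlift ord_max i is Some j then v j else t.
rewrite -[RHS](f0 w).
apply: (@mpoly_rmorph_ext _ _ _
  ((horner_eval t \o map_poly (meval v)) \o phi) (meval w)) => [c|i] /=.
  by rewrite /phi mmapC /= map_polyC /horner_eval /= !mevalC hornerC.
rewrite /phi mmapX mmap1U /h /horner_eval mevalXU /w.
case: unliftP => [j _|_]; last by rewrite map_polyX hornerX.
by rewrite map_polyC /= mevalXU hornerC.
Qed.

Lemma mpoly_ext n (f g : {mpoly F[n]}) :
  (forall x : 'rV[F]_n, f.@[x 0] = g.@[x 0]) -> f = g.
Proof.
move=> fg; apply/eqP; rewrite -subr_eq0; apply/eqP/mpoly_fun0 => v.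
have /= := fg (\row_i v i); rewrite (@meval_eq _ _ _ v) => [|i]; last by rewrite mxE.
rewrite (@meval_eq _ _ _ v) => [|i]; last by rewrite mxE.
by rewrite mevalB => ->; rewrite subrr.
Qed.

End PolynomialFunctions.

Lemma meval_widen_vars (F : fieldType) n (J : {set 'I_n}) (f : {mpoly F[#|J|]})
    (x : 'rV[F]_n) :
  (widen_vars f).@[x 0] = f.@[restrict_cols J x 0].
Proof.
rewrite comp_mpoly_meval; apply: meval_eq => k.
by rewrite tnth_mktuple mevalXU mxE.
Qed.

Lemma meval_linear_subst (F : fieldType) n (M : 'M[F]_n) (f : {mpoly F[n]})
    (x : 'rV[F]_n) :
  (linear_subst M f).@[x 0] = f.@[(x *m M) 0].
Proof.
rewrite comp_mpoly_meval; apply: meval_eq => k.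
rewrite tnth_mktuple raddf_sum mxE; apply: eq_bigr => j _ /=.
by rewrite mevalZ mevalXU mulrC.
Qed.

(** * Splitting F^n as F^J x F^(~: J) *)

Section ExtendByZero.

Variables (F : fieldType) (n : nat).

(** The sum has a single term when [i] is in [J] and is empty otherwise. *)
Definition extend_cols (J : {set 'I_n}) (y : 'rV[F]_#|J|) : 'rV[F]_n :=
  \row_i \sum_(k | enum_val k == i) y 0 k.

Lemma extend_cols_in (J : {set 'I_n}) (y : 'rV[F]_#|J|) k :
  extend_cols y 0 (enum_val k) = y 0 k.
Proof.
rewrite mxE (eq_bigl (fun l => l == k)) ?big_pred1_eq // => l.
by rewrite (inj_eq enum_val_inj).
Qed.

Lemma extend_cols_notin (J : {set 'I_n}) (y : 'rV[F]_#|J|) i :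
  i \notin J -> extend_cols y 0 i = 0.
Proof.
move=> iJ; rewrite mxE big_pred0 // => k.
by apply: contraNF iJ => /eqP <-; apply: enum_valP.
Qed.

Lemma enum_val_surj (J : {set 'I_n}) i :
  i \in J -> exists k : 'I_#|J|, i = enum_val k.
Proof. by move=> iJ; exists (enum_rank_in iJ i); rewrite enum_rankK_in. Qed.

Lemma extend_cols_restrict (J : {set 'I_n}) (x : 'rV[F]_n) i :
  i \in J -> extend_cols (restrict_cols J x) 0 i = x 0 i.
Proof. by case/enum_val_surj => k ->; rewrite extend_cols_in mxE. Qed.

Lemma restrict_cols_merge (J : {set 'I_n}) (y : 'rV[F]_#|J|)
    (z : 'rV[F]_#|~: J|%SET) :
  restrict_cols J (extend_cols y + extend_cols z) = y.
Proof.
apply/rowP => k; rewrite [LHS]mxE [LHS]mxE extend_cols_in extend_cols_notin.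
  by rewrite addr0.
by rewrite inE enum_valP.
Qed.

Lemma restrict_colsC_merge (J : {set 'I_n}) (y : 'rV[F]_#|J|)
    (z : 'rV[F]_#|~: J|%SET) :
  restrict_cols (~: J)%SET (extend_cols y + extend_cols z) = z.
Proof.
apply/rowP => k; rewrite [LHS]mxE [LHS]mxE extend_cols_in extend_cols_notin.
  by rewrite add0r.
by have := enum_valP k; rewrite inE.
Qed.

Lemma extend_cols_split (J : {set 'I_n}) (x : 'rV[F]_n) :
  x = extend_cols (restrict_cols J x) + extend_cols (restrict_cols (~: J)%SET x).
Proof.
apply/rowP => i; rewrite [RHS]mxE; have [iJ|iJ] := boolP (i \in J).
  by rewrite extend_cols_restrict // extend_cols_notin ?addr0 // inE negbK.
by rewrite extend_cols_notin // extend_cols_restrict ?add0r // inE.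
Qed.

End ExtendByZero.

(** * The vanishing ideal of a product *)

Section ProductIdeal.

Variables (F : numFieldType) (n : nat) (J : {set 'I_n}).

(** Expand [f] in the variables of [J], with coefficients in the remaining ones. At each z in [W]
    the resulting polynomial on F^J vanishes identically, so every coefficient lies in the ideal of
    [W]. *)
Lemma vanishing_ideal_cylinder (I : set {mpoly F[#|J|]})
    (W : set 'rV[F]_#|~: J|%SET) (f : {mpoly F[n]}) :
  (forall x : 'rV_n, W (restrict_cols (~: J)%SET x) -> f.@[x 0] = 0) ->
  scheme_product I (vanishing_ideal W) f.
Proof.
move=> f0.
(* Exactly one of the two sums is nonempty: x_i becomes an outer variable if [i] is in [J], a
   constant coefficient otherwise. *)
pose h i : {mpoly {mpoly F[#|~: J|%SET]}[#|J|]} :=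
  \sum_(k | enum_val k == i) 'X_k + (\sum_(k | enum_val k == i) 'X_k)%:MP.
pose phi := mmap ((@mpolyC #|J| _) \o @mpolyC #|~: J|%SET F) h.
pose psi := mmap (@comp_mpoly _ F n [tuple 'X_(enum_val k) | k < #|~: J|%SET])
  (fun k : 'I_#|J| => 'X_(enum_val k)).
have psiphi : psi (phi f) = f.
  apply: (@mpoly_rmorph_ext _ _ _ (psi \o phi) idfun) => [c|i] /=.
    by rewrite /phi /psi !mmapC /= comp_mpolyC.
  rewrite /phi mmapX mmap1U /h /psi raddfD /= mmapC raddf_sum /=.
  apply: mpoly_ext => x; rewrite mevalXU mevalD -/(widen_vars _) meval_widen_vars.
  rewrite !raddf_sum /= {3}(extend_cols_split J x) !mxE.
  congr (_ + _); apply: eq_bigr => k _.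
    by rewrite mmapX mmap1U mevalXU mxE.
  by rewrite mevalXU.
rewrite -psiphi /psi /mmap; apply: generated_ideal_sum => m _.
rewrite mulrC; apply: generated_idealM; apply: generated_ideal_gen; right.
exists (phi f)@_m => // z Wz.
rewrite -mcoeff_map_mpoly (_ : map_mpoly _ _ = 0) ?mcoeff0 //.
apply: mpoly_ext => y; rewrite meval0 -(f0 (extend_cols y + extend_cols z)); last first.
  by rewrite restrict_colsC_merge.
apply: (@mpoly_rmorph_ext _ _ _
  ((meval (y 0) \o map_mpoly (meval (z 0))) \o phi) (meval _)) => [c|i] /=.
  by rewrite /phi mmapC /= map_mpolyC !mevalC /= mevalC.
rewrite /phi mmapX mmap1U /h raddfD /= map_mpolyC raddf_sum /= mevalD mevalC.
rewrite mevalXU !mxE !raddf_sum.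
by congr (_ + _); apply: eq_bigr => k _ /=; rewrite ?map_mpolyX mevalXU.
Qed.

(** Compose [f] with the projection [Q] of F^J onto the row space of [C]. The composite vanishes on
    the whole cylinder over [W], and it differs from [f] by a combination of the linear forms x_l -
    (x Q)_l, which vanish on the row space. *)
Lemma vanishing_ideal_product r (C : 'M[F]_(r, #|J|))
    (W : set 'rV[F]_#|~: J|%SET) (f : {mpoly F[n]}) :
  (forall x : 'rV_n, (restrict_cols J x <= C)%MS ->
    W (restrict_cols (~: J)%SET x) -> f.@[x 0] = 0) ->
  scheme_product (vanishing_ideal [set u : 'rV_#|J| | (u <= C)%MS])
    (vanishing_ideal W) f.
Proof.
move=> f0; pose Q := pinvmx C *m C.
pose pr (x : 'rV[F]_n) :=
  extend_cols (restrict_cols J x *m Q) + extend_cols (restrict_cols (~: J)%SET x).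
pose a i : {mpoly F[n]} := if [pick k : 'I_#|J| | enum_val k == i] is Some k
  then widen_vars (\sum_l Q l k *: 'X_l) else 'X_i.
have a_eval i (x : 'rV[F]_n) : (a i).@[x 0] = pr x 0 i.
  rewrite /a; case: pickP => [k /eqP <-|/= iJ].
    rewrite meval_widen_vars raddf_sum /= [RHS]mxE extend_cols_in.
    rewrite extend_cols_notin ?addr0 ?inE ?enum_valP // mxE.
    by apply: eq_bigr => l _; rewrite mevalZ mevalXU mulrC.
  have iJ' : i \notin J.
    by apply/negP => /enum_val_surj[k ik]; have := iJ k; rewrite ik eqxx.
  by rewrite mevalXU [RHS]mxE extend_cols_notin // extend_cols_restrict ?add0r ?inE.
rewrite -(subrK (f \mPo [tuple a i | i < n]) f).
apply: generated_idealD; last first.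
  apply: vanishing_ideal_cylinder => x Wx.
  rewrite comp_mpoly_meval -(f0 (pr x)) ?restrict_cols_merge //.
  - by apply: meval_eq => i; rewrite tnth_mktuple a_eval.
  - by rewrite mulmxA submxMl.
  - by rewrite restrict_colsC_merge.
rewrite -{1}[f]comp_mpoly_id; apply: comp_mpoly_congr => i.
rewrite !tnth_mktuple /a; case: pickP => [l /eqP <-|_]; last first.
  by rewrite subrr; apply: generated_ideal0.
apply: generated_ideal_gen; left.
exists ('X_l - \sum_m Q m l *: 'X_m); last first.
  by rewrite /widen_vars raddfB /= comp_mpolyXU -tnth_nth tnth_mktuple.
move=> u /= uC; rewrite mevalB mevalXU -{1}(mulmxKpV uC) -mulmxA -/Q mxE.
rewrite [X in _ - X]raddf_sum /= -sumrB big1 // => m _.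
by rewrite mevalZ mevalXU mulrC subrr.
Qed.

End ProductIdeal.

(** * Substitution and evaluation *)

Lemma mmap_comp_mpoly (R S : comNzRingType) m n (f : {rmorphism R -> S})
    (h : 'I_n -> S) (q : {mpoly R[m]}) (lq : m.-tuple {mpoly R[n]}) :
  mmap f h (q \mPo lq) = mmap f (fun i => mmap f h (tnth lq i)) q.
Proof.
apply: (@mpoly_rmorph_ext _ _ _ (mmap f h \o comp_mpoly lq) (mmap f _))
  => [c|i] /=; first by rewrite comp_mpolyC !mmapC.
by rewrite comp_mpolyXU mmapX mmap1U -tnth_nth.
Qed.

Lemma mmap_ext n (R S : nzRingType) (f : R -> S) (h1 h2 : 'I_n -> S)
    (q : {mpoly R[n]}) :
  h1 =1 h2 -> mmap f h1 q = mmap f h2 q.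
Proof.
by move=> h12; apply: eq_bigr => m _; congr (_ * _); apply: mmap1_eq.
Qed.

Lemma horner_mmap n (R : comNzRingType) (h : 'I_n -> {poly R})
    (q : {mpoly R[n]}) (t : R) :
  (mmap polyC h q).[t] = q.@[fun i => (h i).[t]].
Proof.
apply: (@mpoly_rmorph_ext _ _ _ (horner_eval t \o mmap polyC h) (meval _))
  => [c|i] /=; first by rewrite mmapC mevalC /horner_eval /= hornerC.
by rewrite mmapX mmap1U mevalXU.
Qed.

(** * Homogeneous components and initial forms *)

Section HomogeneousComponents.

Variables (F : fieldType) (n : nat).
Implicit Types f : {mpoly F[n]}.

Lemma mcoeff_pihomog d f m :
  (pihomog mdeg d f)@_m = if mdeg m == d then f@_m else 0.
Proof.
elim/mpolyind: f => [|c m' f _ _ IHf]; first by rewrite raddf0 mcoeff0 if_same.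
rewrite raddfD mcoeffD /= IHf linearZ mcoeffZ /= pihomogX mcoeffD mcoeffZ mcoeffX.
have [<-|m'm] := eqVneq m' m.
  by case: ifP; rewrite ?mcoeff0 ?mcoeffX ?eqxx // mulr0 addr0.
rewrite mulr0 add0r; case: (mdeg m' == d); rewrite ?mcoeff0 ?mcoeffX ?(negPf m'm);
by rewrite mulr0 add0r.
Qed.

Lemma initial_degree_le f m : m \in msupp f -> (initial_degree f <= mdeg m)%N.
Proof.
rewrite /initial_degree; elim: (msupp f) => //= m' s IHs.
rewrite inE big_cons => /orP[/eqP <-|/IHs]; first exact: geq_minl.
exact/leq_trans/geq_minr.
Qed.

Lemma pihomog_lt_initial f d : (d < initial_degree f)%N -> pihomog mdeg d f = 0.
Proof.
move=> lt_d; apply/mpolyP => m; rewrite mcoeff_pihomog mcoeff0.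
case: eqP => // md; apply/eqP; rewrite mcoeff_eq0; apply/negP.
by move=> /initial_degree_le; rewrite leqNgt md lt_d.
Qed.

Lemma initial_formE f e :
  (forall d, (d < e)%N -> pihomog mdeg d f = 0) -> pihomog mdeg e f != 0 ->
  initial_form f = pihomog mdeg e f.
Proof.
move=> low /eqP fe0; rewrite /initial_form; suff -> : initial_degree f = e by [].
apply/eqP; rewrite eqn_leq; apply/andP; split.
  rewrite leqNgt; apply/negP => /pihomog_lt_initial; exact: fe0.
have ge_e m : m \in msupp f -> (e <= mdeg m)%N.
  rewrite mcoeff_msupp leqNgt; apply: contraNN => /low /(congr1 (mcoeff m)).
  by rewrite mcoeff_pihomog eqxx mcoeff0 => ->.
rewrite /initial_degree big_seq; elim/big_ind: _ => //; last first.
  by move=> a b ea eb; rewrite leq_min ea.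
(* The minimum starts from the default [msize f], which exceeds every degree in the support; a
   nonzero component of degree [e] therefore forces [e] not to exceed it. *)
rewrite leqNgt; apply/negP => lt_e; apply: fe0; apply/mpolyP => m.
rewrite mcoeff_pihomog mcoeff0; case: eqP => // me; apply/eqP.
by rewrite mcoeff_eq0 msize_mdeg_ge // me ltnW.
Qed.

End HomogeneousComponents.

(** * Initial forms along lines and curves *)

Section Lines.

Variables (F : numFieldType) (n : nat).
Implicit Types (f g : {mpoly F[n]}) (y : 'I_n -> F).

Definition restrict_line y f : {poly F} := mmap polyC (fun i => 'X * (y i)%:P) f.

Lemma coef_restrict_line y f d :
  (restrict_line y f)`_d = (pihomog mdeg d f).@[y].
Proof.
have homogE q e : q \is e.-homog -> restrict_line y q = 'X^e * (q.@[y])%:P.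
  move=> homq; rewrite /restrict_line (mmap_homog _ _ _ homq); congr (_ * _).
  apply: (@mpoly_rmorph_ext _ _ _ (mmap polyC _) (polyC \o meval y)) => [c|i] /=.
    by rewrite mmapC mevalC.
  by rewrite mmapX mmap1U mevalXU.
rewrite {1}(pihomog_partitionE (leqnn (mmeasure mdeg f))) /restrict_line.
rewrite raddf_sum coef_sum /=.
under eq_bigr => i _ do
  rewrite -/(restrict_line _ _) (homogE _ _ (pihomogP mdeg i f)) coefMC coefXn.
have [lt_d|le_d] := ltnP d (mmeasure mdeg f).
  rewrite (bigD1 (Ordinal lt_d)) //= eqxx mul1r big1 ?addr0 // => i.
  by rewrite -val_eqE /= eq_sym => /negPf ->; rewrite mul0r.
rewrite big1 => [|i _]; last by rewrite gtn_eqF ?mul0r // (leq_trans _ le_d).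
rewrite (_ : pihomog _ _ _ = 0) ?meval0 //; apply/mpolyP => m.
rewrite mcoeff_pihomog mcoeff0; case: eqP => // md; apply/eqP.
by rewrite mcoeff_eq0 msize_mdeg_ge // md.
Qed.

(** For x in the cone [W], f(t x) vanishes for all t != 0, so all its coefficients in t vanish;
    these are the values at x of the components of [f]. *)
Lemma vanishing_ideal_pihomog (W : set 'rV[F]_n) f d :
  (forall t x, t != 0 -> W x -> W (t *: x)) ->
  vanishing_ideal W f -> vanishing_ideal W (pihomog mdeg d f).
Proof.
move=> Wscale f0 x Wx; rewrite -coef_restrict_line.
rewrite (_ : restrict_line _ _ = 0) ?coef0 //.
apply: (@poly_fun0_away _ 'X) => [|t]; first by rewrite polyX_eq0.
rewrite hornerX horner_mmap => t0; rewrite -(f0 (t *: x)); last exact: Wscale.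
by apply: meval_eq => i; rewrite hornerM hornerX hornerC mxE.
Qed.

(** Along p + t y each argument of [f] is t y_(s i) C_i(p + t y), so homogeneity pulls out t^e, and
    the coefficient of t^e is D(p) k h(y). Hence [h] is, up to a nonzero constant, the initial form
    at p of the given equation. *)
Lemma tangent_cone_mem (X : set 'rV[F]_n) (p : 'rV[F]_n) r
    (f : {mpoly F[r]}) e (s : 'I_r -> 'I_n) (k : F) (D h : {mpoly F[n]})
    (C : 'I_r -> {mpoly F[n]}) :
  f \is e.-homog -> k != 0 -> D.@[p 0] != 0 ->
  vanishing_ideal X
    (D * (f \mPo [tuple ('X_(s i) - (p 0 (s i))%:MP) * C i | i < r])) ->
  (forall y : 'rV_n, f.@[fun i => y 0 (s i) * (C i).@[p 0]] = k * h.@[y 0]) ->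
  tangent_cone X p h.
Proof.
set G := D * _ => homf k0 Dp GX fh.
have [->|h0] := eqVneq h 0; first exact: generated_ideal0.
pose L (y : 'rV_n) g := restrict_line (y 0) (translate p g).
have horner_L (y : 'rV_n) g : (L y g).[0] = g.@[p 0].
  rewrite horner_mmap comp_mpoly_meval; apply: meval_eq => i.
  by rewrite tnth_mktuple mevalD mevalXU mevalC hornerM hornerX mul0r add0r.
have LG (y : 'rV_n) :
    L y G = 'X^e * (L y D * mmap polyC (fun i => (y 0 (s i))%:P * L y (C i)) f).
  rewrite /L /translate /G rmorphM /= /restrict_line rmorphM /= mulrCA.
  congr (_ * _); rewrite -(mmap_homog _ _ _ homf) !mmap_comp_mpoly.
  apply: mmap_ext => i; rewrite tnth_mktuple !rmorphM /= mulrA; congr (_ * _).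
  rewrite mmapB mmapX mmap1U mmapC tnth_mktuple mmapD mmapX mmap1U mmapC.
    by rewrite addrK.
  by rewrite mmap_comp_mpoly.
have LGe (y : 'rV_n) : (L y G)`_e = (D.@[p 0] * k) * h.@[y 0].
  rewrite LG coefXnM ltnn subnn -horner_coef0 hornerM horner_L horner_mmap -mulrA.
  rewrite -fh; congr (_ * _); apply: meval_eq => i.
  by rewrite hornerM hornerC horner_L.
have He : pihomog mdeg e (translate p G) = (D.@[p 0] * k)%:MP * h.
  apply: mpoly_ext => y; rewrite -coef_restrict_line mevalM mevalC.
  exact: LGe.
have Dk : D.@[p 0] * k != 0 by rewrite mulf_neq0.
have He0 : pihomog mdeg e (translate p G) != 0.
  by rewrite He mul_mpolyC scaler_eq0 negb_or Dk.
have inH : initial_form (translate p G) = pihomog mdeg e (translate p G).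
  apply: initial_formE => // d lt_de; apply: mpoly_ext => y.
  by rewrite -coef_restrict_line meval0 -/(L y G) LG coefXnM lt_de.
have -> : h = (D.@[p 0] * k)^-1%:MP * initial_form (translate p G).
  by rewrite inH He mulrA -mpolyCM mulVf // mul1r.
apply: generated_idealM; apply: generated_ideal_gen; exists G => //; split => //.
by apply: contraNneq He0 => ->; rewrite /translate !raddf0.
Qed.

(** Dividing f(t a/b) by t^e, with e the initial degree, and letting t tend to 0 leaves the initial
    form at a(0)/b(0). Clearing denominators makes this algebraic. *)
Lemma initial_form_curve f (a b : 'I_n -> {poly F}) :
  (forall i, (b i).[0] != 0) ->
  (forall t, t != 0 -> (forall i, (b i).[t] != 0) ->
    f.@[fun i => t * ((a i).[t] / (b i).[t])] = 0) ->
  (initial_form f).@[fun i => (a i).[0] / (b i).[0]] = 0.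
Proof.
move=> b0 f0; pose B := \prod_i b i.
pose c i := a i * \prod_(j | j != i) b j.
have B0 : B.[0] != 0.
  by rewrite horner_prod prodf_seq_neq0; apply/allP => i _; apply: b0.
have quotE t : B.[t] != 0 ->
    forall i, (a i).[t] / (b i).[t] = B.[t]^-1 * (c i).[t].
  rewrite /B horner_prod => Bt i; rewrite hornerM horner_prod mulrCA.
  congr (_ * _); move: Bt; rewrite (bigD1 i) //= mulf_eq0 negb_or => /andP[bi bj].
  by rewrite invfM mulfVK.
(* [N] lies above all degrees in [f], and above [e] even when [f] is zero. *)
pose e := initial_degree f; pose N := maxn e.+1 (mmeasure mdeg f).
have ltN : (e < N)%N by rewrite leq_max leqnn.
pose T d := mmap polyC c (pihomog mdeg d f).
(* This is B^N t^-e f(t c/B), with a_i/b_i = c_i/B, written as a polynomial in t. *)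
pose Q := \sum_(d < N | (e <= d)%N) B ^+ (N - d) * 'X^(d - e) * T d.
have homT t d : (pihomog mdeg d f).@[fun i => t * (B.[t]^-1 * (c i).[t])]
    = (t / B.[t]) ^+ d * (T d).[t].
  rewrite horner_mmap -(mmap_homog _ _ _ (pihomogP mdeg d f)).
  by apply: mmap_ext => i; rewrite mulrA.
have Q0 : Q = 0.
  apply: (@poly_fun0_away _ ('X * B)) => [|t].
    rewrite mulf_neq0 ?polyX_eq0 //.
    by apply: contraNneq B0 => ->; rewrite horner0.
  rewrite hornerM hornerX mulf_eq0 negb_or => /andP[t0 Bt].
  have bt i : (b i).[t] != 0.
    by move: Bt; rewrite horner_prod (bigD1 i) //= mulf_eq0 negb_or => /andP[].
  have := f0 t t0 bt.
  rewrite (pihomog_partitionE (leq_maxr e.+1 (mmeasure mdeg f))) -/N raddf_sum /=.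
  rewrite (bigID (fun d : 'I_N => (e <= d)%N)) /= [X in _ + X]big1 => [|d]; last first.
    by rewrite -ltnNge => /pihomog_lt_initial ->; rewrite meval0.
  rewrite addr0 => /(congr1 (fun z => B.[t] ^+ N / t ^+ e * z)).
  rewrite mulr0 => <-; rewrite mulr_sumr horner_sum; apply: eq_bigr => d le_ed.
  rewrite (@meval_eq _ _ _ (fun i => t * (B.[t]^-1 * (c i).[t]))) => [|i]; last first.
    by rewrite quotE.
  rewrite homT !hornerM !horner_exp hornerX mulrA; congr (_ * _).
  rewrite expr_div_n !expfB_cond ?(negPf t0) ?(negPf Bt) // ?(ltnW (ltn_ord d)) //.
  by rewrite mulrACA [RHS]mulrACA; congr (_ * _); rewrite mulrC.
have := congr1 (horner^~ 0) Q0; rewrite /Q horner_sum horner0.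
rewrite (bigD1 (Ordinal ltN)) //= subnn expr0 mulr1.
rewrite big1 ?addr0 => [|d /andP[le_ed ned]].
  rewrite hornerM horner_exp => /eqP; rewrite mulf_eq0 expf_eq0 (negPf B0) andbF /=.
  move=> /eqP Te; rewrite (@meval_eq _ _ _ (fun i => B.[0]^-1 * (c i).[0])) => [|i].
    rewrite /meval (mmap_homog _ _ _ (pihomogP mdeg _ f)) -/(meval _ _) -horner_mmap.
    by rewrite Te mulr0.
  exact: quotE.
rewrite !hornerM hornerXn expr0n subn_eq0 leqNgt ltn_neqAle le_ed.
by rewrite -val_eqE /= eq_sym in ned; rewrite ned mulr0 mul0r.
Qed.

End Lines.

(** * Equations of the reciprocal plane *)

Section Reciprocals.

Variable F : fieldType.

Lemma restrict_colsM (d e n : nat) (K : {set 'I_n}) (w : 'M[F]_(e, d))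
    (B : 'M[F]_(d, n)) :
  restrict_cols K (w *m B) = w *m restrict_cols K B.
Proof. by apply/matrixP => i j; rewrite !mxE; apply: eq_bigr => l _; rewrite !mxE. Qed.

Lemma vanishing_ideal_closure n (X : set 'rV[F]_n) :
  vanishing_ideal (zariski_closure X) = vanishing_ideal X.
Proof.
apply/seteqP; split => f fX x Xx; last exact: Xx.
by apply: fX => g; apply.
Qed.

Lemma vanishing_ideal_reciprocal n (L : set 'rV[F]_n) (f : {mpoly F[n]}) :
  vanishing_ideal (reciprocal_plane L) f <->
  forall u, L u -> (forall i, u 0 i != 0) -> f.@[map_mx GRing.inv u 0] = 0.
Proof.
rewrite /reciprocal_plane vanishing_ideal_closure; split => [fL u Lu u0|fL x].
  by apply: fL; exists u.
by case=> u [Lu u0] <-; apply: fL.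
Qed.

Lemma prod_inv_coord n (K : {set 'I_n}) (x : 'rV[F]_n) (i : 'I_#|K|) :
  x 0 (enum_val i) != 0 ->
  \prod_(l < #|K| | l != i) x 0 (enum_val l)
    = (\prod_(l < #|K|) x 0 (enum_val l)) / x 0 (enum_val i).
Proof. by move=> xi; rewrite [X in X / _](bigD1 i) //= [RHS]mulrC mulKf. Qed.

End Reciprocals.

(** * The tangent cone at p, over a general field of characteristic zero *)

Section TangentCone.

Variables (F : numFieldType) (d n : nat) (B : 'M[F]_(d, n)) (p : 'rV[F]_n).

Let L := [set u : 'rV[F]_n | (u <= B)%MS].
Hypothesis p_in : reciprocal_plane L p.

Let J := point_support p.
Let BJ := restrict_cols J B.
Let LJ := [set u : 'rV[F]_#|J| | (u <= BJ)%MS].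
Let W :=
  [set restrict_cols (~: J)%SET u | u in [set u | L u /\ restrict_cols J u = 0]].
(** On [J] the entries are, up to sign, the derivative of inversion at p. *)
Let M := diag_mx (\row_i if i \in J then (p 0 i) ^- 2 else 1).

Let LD u v : L u -> L v -> L (u + v).
Proof. exact: addmx_sub. Qed.

Let LZ t u : L u -> L (t *: u).
Proof. exact: scalemx_sub. Qed.

Let p_neq0 (k : 'I_#|J|) : p 0 (enum_val k) != 0.
Proof. by have := enum_valP k; rewrite inE. Qed.

Let mulM (x : 'rV[F]_n) i :
  (x *m M) 0 i = x 0 i * (if i \in J then (p 0 i) ^- 2 else 1).
Proof. by rewrite mul_mx_diag !mxE. Qed.

Let M_unit : M \in unitmx.
Proof.
rewrite unitmxE det_diag unitfE prodf_seq_neq0; apply/allP => i _ /=.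
rewrite mxE; case: ifP => [|_]; last exact: oner_neq0.
by rewrite inE => pi; rewrite invr_neq0 // expf_neq0.
Qed.

(** Multiplication by [prodJ] clears the denominators of 1/x on [J], and [prodJ' k] stands for
    [prodJ] / x_k. *)
Let prodJ : {mpoly F[n]} := \prod_(k < #|J|) 'X_(enum_val k).
Let prodJ' (k : 'I_#|J|) : {mpoly F[n]} := \prod_(l < #|J| | l != k) 'X_(enum_val l).

Let eval_prodJ (x : 'rV[F]_n) :
  prodJ.@[x 0] = \prod_(k < #|J|) x 0 (enum_val k).
Proof. by rewrite rmorph_prod; apply: eq_bigr => k _; rewrite /= mevalXU. Qed.

Let eval_prodJ' (x : 'rV[F]_n) k :
  x 0 (enum_val k) != 0 ->
  (prodJ' k).@[x 0] = prodJ.@[x 0] / x 0 (enum_val k).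
Proof.
move=> xk; rewrite eval_prodJ -prod_inv_coord // rmorph_prod.
by apply: eq_bigr => l _; rewrite /= mevalXU.
Qed.

Let prodJ_p : prodJ.@[p 0] != 0.
Proof. by rewrite eval_prodJ prodf_seq_neq0; apply/allP => k _ /=. Qed.

(** The linear equations of L_J, applied to 1/x and multiplied by [prodJ], are equations of L^-1. At
    p, where [prodJ] is nonzero, they say that 1/p restricted to [J] lies in L_J. *)
Lemma reciprocal_point : exists2 q, L q & forall i, i \in J -> q 0 i = (p 0 i)^-1.
Proof.
pose r := restrict_cols J (map_mx GRing.inv p).
pose N := cokermx BJ.
pose h l := \sum_k N k l *: prodJ' k.
have eval_h (x : 'rV[F]_n) l : (forall k : 'I_#|J|, x 0 (enum_val k) != 0) ->
    (h l).@[x 0] = prodJ.@[x 0] * (restrict_cols J (map_mx GRing.inv x) *m N) 0 l.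
  move=> x0; rewrite raddf_sum /= mxE mulr_sumr; apply: eq_bigr => k _.
  by rewrite mevalZ eval_prodJ' // !mxE; ring.
suff /submxP[w rw] : (r <= BJ)%MS.
  exists (w *m B); first exact: submxMl.
  move=> i /enum_val_surj[k ->]; have /rowP/(_ k) := rw.
  by rewrite /BJ -restrict_colsM !mxE.
rewrite submxE; apply/eqP/rowP => l.
have: (h l).@[p 0] = 0.
  apply: p_in => _ [u [Lu u0] <-]; rewrite eval_h => [|k]; last first.
    by rewrite mxE invr_neq0.
  rewrite (_ : map_mx _ (map_mx _ u) = u); last by apply/rowP => i; rewrite !mxE invrK.
  have /submxP[w ->] : (u <= B)%MS := Lu.
  by rewrite restrict_colsM -mulmxA mulmx_coker mulmx0 mxE mulr0.
rewrite eval_h // => /eqP; rewrite mulf_eq0 (negPf prodJ_p) /= => /eqP ->.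
by rewrite mxE.
Qed.

Lemma tangent_cone_vanish g (v u y : 'rV[F]_n) :
  tangent_cone (reciprocal_plane L) p g -> L v -> L u ->
  (forall i, i \in J -> u 0 i = 0) -> (forall i, i \notin J -> u 0 i != 0) ->
  (forall i, y 0 i = if i \in J then p 0 i ^+ 2 * v 0 i else (u 0 i)^-1) ->
  g.@[y 0] = 0.
Proof.
move=> [s sI ->] Lv Lu uJ uJC yE; rewrite raddf_sum big_seq big1 // => hg /sI.
case=> f [fX f0] <- /=; rewrite mevalM (_ : (initial_form _).@[_] = 0) ?mulr0 //.
have [q Lq qJ] := reciprocal_point.
(* The displacement of the curve from p is t a/b. On [J], p_i q_i = 1 gives 1/(q_i - t v_i) - p_i =
   t p_i v_i/(q_i - t v_i); off [J], p_i = 0 and 1/(q_i - t v_i + u_i/t) = t/(u_i + t q_i - t^2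
   v_i). *)
pose a i : {poly F} := if i \in J then (p 0 i * v 0 i)%:P else 1.
pose b i : {poly F} := if i \in J then (q 0 i)%:P - (v 0 i)%:P * 'X
  else (u 0 i)%:P + (q 0 i)%:P * 'X - (v 0 i)%:P * 'X^2.
have pJ i : i \in J -> p 0 i != 0 by rewrite inE.
have b0 i : (b i).[0] = if i \in J then q 0 i else u 0 i.
  rewrite /b; case: ifP => _; rewrite !hornerE /=; last by ring.
  by ring.
rewrite (@meval_eq _ _ _ (fun i => (a i).[0] / (b i).[0])) => [|i]; last first.
  rewrite b0 yE /a; case: ifP => iJ; rewrite !hornerE // qJ // invrK; last by ring.
apply: initial_form_curve => [i|t t0 bt].
  rewrite b0; case: ifPn => [iJ|]; last exact: uJC.
  by rewrite qJ // invr_neq0 // pJ.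
pose ut := q + (- t) *: v + t^-1 *: u.
have utE i : ut 0 i = (b i).[t] * (if i \in J then 1 else t^-1).
  rewrite !mxE /b; case: ifP => iJ; rewrite !hornerE /=.
    by rewrite uJ //; ring.
  by field.
have {fX} /vanishing_ideal_reciprocal fX := fX.
rewrite -(fX ut).
- rewrite comp_mpoly_meval; apply: meval_eq => i.
  rewrite tnth_mktuple mevalD mevalXU mevalC [RHS]mxE utE.
  have := bt i; rewrite /a /b; case: ifP => iJ; rewrite !hornerE /= => bi.
    have := pJ i iJ; move: bi; rewrite qJ // => bi pi.
    field; rewrite pi; move: bi; apply: contra => /eqP bi.
    apply/eqP/(mulfI pi); rewrite mulr0 -[RHS]bi; field; exact: pi.
  have /eqP -> : p 0 i == 0 by move: iJ; rewrite inE => /negbFE.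
  by rewrite addr0 mulr1 invfM invrK mulrC.
- by rewrite /ut; apply: LD; [apply: LD => //|]; apply: LZ.
- move=> i; rewrite utE mulf_neq0 //; case: ifP => _; first exact: oner_neq0.
  by rewrite invr_neq0.
Qed.

Lemma tangent_cone_linear (g : {mpoly F[#|J|]}) e :
  g \is e.-homog -> vanishing_ideal LJ g ->
  tangent_cone (reciprocal_plane L) p (linear_subst M (widen_vars g)).
Proof.
move=> homg g0; have [q Lq qJ] := reciprocal_point.
(* Chosen so that (x_i - p_i) C_i = [prodJ] (1/x_i - 1/p_i), while C_i(p) = - [prodJ](p) p_i^-2. *)
pose C (i : 'I_#|J|) : {mpoly F[n]} := - (p 0 (enum_val i))^-1 *: prodJ' i.
apply: (@tangent_cone_mem _ _ _ _ _ g e enum_val ((- prodJ.@[p 0]) ^+ e) 1 _ C) => //.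
- by rewrite expf_neq0 // oppr_eq0.
- by rewrite meval1 oner_neq0.
- apply/vanishing_ideal_reciprocal => u Lu u0; rewrite mul1r comp_mpoly_meval.
  pose x := map_mx GRing.inv u.
  rewrite -[RHS](g0 (prodJ.@[x 0] *: restrict_cols J (u - q))); last first.
    apply: scalemx_sub; have /submxP[w ->] : (u - q <= B)%MS.
      by rewrite addmx_sub // eqmx_opp.
    by rewrite restrict_colsM submxMl.
  apply: meval_eq => i; rewrite tnth_mktuple mevalM mevalB mevalXU mevalC mevalZ.
  have ui := u0 (enum_val i).
  rewrite eval_prodJ' ?mxE ?invr_neq0 // qJ ?enum_valP // -/x.
  by field; rewrite ui p_neq0.
- move=> y; rewrite meval_linear_subst meval_widen_vars -meval_homog //.
  apply: meval_eq => i; rewrite mevalZ eval_prodJ' // mxE mulM enum_valP.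
  by field; rewrite p_neq0.
Qed.

Lemma tangent_cone_contraction (g : {mpoly F[#|~: J|%SET]}) e :
  g \is e.-homog -> vanishing_ideal (reciprocal_plane W) g ->
  tangent_cone (reciprocal_plane L) p (linear_subst M (widen_vars g)).
Proof.
move=> homg /vanishing_ideal_reciprocal g0.
(* A linear section of the restriction L -> L_J. *)
pose S : 'M[F]_(#|J|, n) := pinvmx BJ *m B.
(* At x = 1/u, D_i equals [prodJ] x_i w_i with w = u - u_J [S], so x_i C_i is the product of all D_l
   divided by w_i. As p_i = 0 off [J], the value C_i(p) is independent of i. *)
pose D (i : 'I_#|~: J|%SET) : {mpoly F[n]} :=
  prodJ - 'X_(enum_val i) * \sum_j S j (enum_val i) *: prodJ' j.
pose C (i : 'I_#|~: J|%SET) : {mpoly F[n]} := prodJ * \prod_(l | l != i) D l.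
have pC (i : 'I_#|~: J|%SET) : p 0 (enum_val i) = 0.
  by have := enum_valP i; rewrite !inE negbK => /eqP.
have iJ (i : 'I_#|~: J|%SET) : (enum_val i \in J) = false.
  by have := enum_valP i; rewrite inE => /negPf.
have Dp i : (D i).@[p 0] = prodJ.@[p 0].
  by rewrite mevalB mevalM mevalXU pC mul0r subr0.
apply: (@tangent_cone_mem _ _ _ _ _ g e enum_val
  ((\prod_(i < #|~: J|%SET) prodJ.@[p 0]) ^+ e) (\prod_i D i) _ C) => //.
- by rewrite expf_neq0 // prodf_seq_neq0; apply/allP.
- by rewrite rmorph_prod prodf_seq_neq0; apply/allP => i _ /=; rewrite Dp.
- apply/vanishing_ideal_reciprocal => u Lu u0; rewrite mevalM comp_mpoly_meval.
  pose x := map_mx GRing.inv u; rewrite -/x.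
  (* If some w_i is zero, 1/w is undefined, but then the prefactor already makes the equation
     hold. *)
  have [->|Dx] := eqVneq (\prod_i D i).@[x 0] 0; first by rewrite mul0r.
  pose w := u - restrict_cols J u *m S.
  have uJ : (restrict_cols J u <= BJ)%MS.
    have /submxP[a ->] : (u <= B)%MS := Lu.
    by rewrite restrict_colsM submxMl.
  have Lw : L w.
    apply: LD => //; rewrite /L /= eqmx_opp mulmxA; exact: submxMl.
  have wJ : restrict_cols J w = 0.
    have -> : restrict_cols J w =
        restrict_cols J u - restrict_cols J (restrict_cols J u *m S).
      by apply/rowP => k; rewrite !mxE.
    by rewrite /S mulmxA restrict_colsM mulmxKpV // subrr.
  have De i : (D i).@[x 0] = prodJ.@[x 0] * x 0 (enum_val i) * w 0 (enum_val i).
    rewrite mevalB mevalM mevalXU raddf_sum /= -mulrA.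
    have -> : w 0 (enum_val i) =
        u 0 (enum_val i) - \sum_j u 0 (enum_val j) * S j (enum_val i).
      rewrite !mxE; congr (_ - _); apply: eq_bigr => j _.
      by rewrite mxE.
    have xu : x 0 (enum_val i) * u 0 (enum_val i) = 1 by rewrite mxE mulVf.
    rewrite mulrBr mulrBr xu mulr1; congr (_ - _).
    rewrite mulrCA; congr (_ * _); rewrite mulr_sumr; apply: eq_bigr => j _.
    rewrite mevalZ eval_prodJ' ?mxE ?invr_neq0 // invrK; ring.
  have Di i : (D i).@[x 0] != 0.
    by move: Dx; rewrite rmorph_prod (bigD1 i) //= mulf_eq0 negb_or => /andP[].
  have wi (i : 'I_#|~: J|%SET) : w 0 (enum_val i) != 0.
    by have := Di i; rewrite De; apply: contraNneq => ->; rewrite mulr0.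
  rewrite (@meval_eq _ _ _ (fun i => (\prod_i D i).@[x 0] *
    map_mx GRing.inv (restrict_cols (~: J)%SET w) 0 i)) => [|i].
    rewrite (meval_homog _ _ homg) g0 ?mulr0 // => [|i]; last by rewrite mxE.
    by exists w.
  rewrite tnth_mktuple mevalM mevalB mevalXU mevalC pC subr0 mevalM.
  rewrite [X in _ * (_ * X)]rmorph_prod [X in _ = X * _]rmorph_prod /=.
  have -> : map_mx GRing.inv (restrict_cols (~: J)%SET w) 0 i = (w 0 (enum_val i))^-1.
    by rewrite !mxE.
  rewrite [in RHS](bigD1 i) //= De.
  by field.
- move=> y; rewrite meval_linear_subst meval_widen_vars -meval_homog //.
  apply: meval_eq => i; rewrite mevalM [X in _ * (_ * X)]rmorph_prod mxE mulM.
  rewrite iJ mulr1; under [X in _ * (_ * X)]eq_bigr => l _ do rewrite /= Dp.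
  by rewrite [in RHS](bigD1 i) //= mulrC.
Qed.

Lemma tangent_cone_widen (K : {set 'I_n}) (V : set 'rV[F]_#|K|) g :
  (forall e g, g \is e.-homog -> vanishing_ideal V g ->
    tangent_cone (reciprocal_plane L) p (linear_subst M (widen_vars g))) ->
  (forall t x, t != 0 -> V x -> V (t *: x)) -> vanishing_ideal V g ->
  tangent_cone (reciprocal_plane L) p (linear_subst M (widen_vars g)).
Proof.
move=> homV Vscale gV.
rewrite (pihomog_partitionE (leqnn (mmeasure mdeg g))).
rewrite [widen_vars _](raddf_sum (@comp_mpoly _ F n _)).
rewrite [linear_subst _ _](raddf_sum (@comp_mpoly _ F n _)).
apply: generated_ideal_sum => e _.
apply: (homV e (pihomog mdeg e g)); first exact: pihomogP.
exact: vanishing_ideal_pihomog.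
Qed.

Theorem tangent_cone_reciprocal_plane :
  linearly_isomorphic (tangent_cone (reciprocal_plane L) p)
    (scheme_product (vanishing_ideal LJ) (vanishing_ideal (reciprocal_plane W))).
Proof.
exists M => // f; split => [[s sI ->]|fT].
  rewrite [linear_subst _ _](raddf_sum (@comp_mpoly _ F n _)) big_seq.
  apply: generated_ideal_sum => hg /sI hgI.
  rewrite /= (rmorphM (@comp_mpoly _ F n _)); apply: generated_idealM.
  case: hgI => -[g g0 <-].
    apply: (tangent_cone_widen _ _ g0) => [e h|t x _]; first exact: tangent_cone_linear.
    exact: scalemx_sub.
  move: g0; rewrite /reciprocal_plane vanishing_ideal_closure => g0.
  apply: (tangent_cone_widen _ _ g0) => [e h homh h0|t x t0 [z [Wz z0] <-]].
    apply: (tangent_cone_contraction homh).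
    by rewrite /reciprocal_plane vanishing_ideal_closure.
  exists (t^-1 *: z); last by apply/rowP => i; rewrite !mxE invfM invrK.
  split => [|i]; last by rewrite mxE mulf_neq0 ?invr_neq0.
  case: Wz => u [Lu uJ] <-; exists (t^-1 *: u); last by apply/rowP => i; rewrite !mxE.
  split; first exact: LZ.
  by apply/rowP => k; move/rowP/(_ k): uJ; rewrite !mxE => ->; rewrite mulr0.
(* Converse inclusion: [f] has to vanish at each x with x_J in L_J and x off [J] the inverse of a
   point of [W] without zero entries. The tangent cone condition is applied at the preimage of x
   under [M]. *)
rewrite /reciprocal_plane vanishing_ideal_closure.
apply: vanishing_ideal_product => x /submxP[a xa] [_ [[u [Lu uJ] <-] u0] ux].
rewrite -(mulmxKV M_unit x) -meval_linear_subst.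
have MV i : (x *m invmx M) 0 i = x 0 i * (if i \in J then p 0 i ^+ 2 else 1).
  rewrite -{2}(mulmxKV M_unit x) mulM; case: ifP => [|_]; last by rewrite !mulr1.
  by rewrite inE => pi; rewrite mulfVK // expf_neq0.
apply: (tangent_cone_vanish fT (v := a *m B) (u := u)) => //
  [|i /enum_val_surj[k ->]|i iJ|i].
- exact: submxMl.
- by have /rowP/(_ k) := uJ; rewrite !mxE.
- have /enum_val_surj[k ->] : i \in (~: J)%SET by rewrite inE.
  by have := u0 k; rewrite mxE.
- rewrite MV; case: ifPn => iJ.
    have [k ->] := enum_val_surj iJ; rewrite mulrC; congr (_ * _).
    by have /rowP/(_ k) := xa; rewrite /BJ -restrict_colsM !mxE.
  have /enum_val_surj[k ->] : i \in (~: J)%SET by rewrite inE.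
  by rewrite mulr1; have /rowP/(_ k) := ux; rewrite !mxE.
Qed.

End TangentCone.

(** * Specialization to the complex row space of a real matrix *)

Theorem theorem24 (R : realType) (d n : nat) (A : 'M[R]_(d, n))
    (rankA : \rank A = d) (A_nz : forall j : 'I_n, col j A != 0)
    (p : 'rV[R[i]]_n) (p_in : reciprocal_plane (row_space A) p) :
  let J := point_support p in
  linearly_isomorphic
    (tangent_cone (reciprocal_plane (row_space A)) p)
    (scheme_product
       (vanishing_ideal (row_space (restrict_cols J A)))
       (vanishing_ideal (reciprocal_plane (row_space (contraction A J))))).
Proof.
move=> J; rewrite row_space_contraction.
have mapR : map_mx (real_complex R) (restrict_cols J A) =
    restrict_cols J (map_mx (real_complex R) A).
  by apply/matrixP => i j; rewrite !mxE.
have -> : row_space (restrict_cols J A) =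
    [set u | (u <= restrict_cols J (map_mx (real_complex R) A))%MS].
  by rewrite /row_space mapR.
exact: tangent_cone_reciprocal_plane p_in.
Qed.
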